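(* 1. Let $\mathcal{T}\subseteq\mathcal{T}_2$ be a Markov-Cayley tree, put $\mathcal{T}_n=\{g\in\mathcal{T}:|g|=n\}$, and suppose that $\gamma=\lim_{n\to\infty}\frac{|\mathcal{T}_{n+1}|}{|\mathcal{T}_n|}$ satisfies $\gamma>1$. Let $\mathcal{A}$ be a finite alphabet, $E=\mathcal{A}^{\mathbb{N}}$, and let $X\subseteq\mathcal{A}^{\mathbb{N}}$ be a nonempty subshift that is not a full shift. Then the axial products on $\mathcal{T}$ satisfy $h(E\times X)>h(X)$ and $h(X\times E)>h(X)$. 2. There is a Markov-Cayley tree $\mathcal{T}\subseteq\mathcal{T}_2$ with $\gamma=\lim_{n\to\infty}\frac{|\mathcal{T}_{n+1}|}{|\mathcal{T}_n|}=1$ such that, for every finite alphabet $\mathcal{A}$, with $E=\mathcal{A}^{\mathbb{N}}$, and every subshift of finite type $X=X_A\subseteq\mathcal{A}^{\mathbb{N}}$ with primitive $0$-$1$ transition matrix $A$, the axial product on $\mathcal{T}$ satisfies $h(E\times X)=h(X)$.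
   Context: $\mathbb{N}=\{1,2,\dots\}$. Let $\mathcal{T}_2$ (the $2$-tree) be the free monoid on generators $f_1,f_2$, with root (identity) $\epsilon$ and word length $|\cdot|$. Given a $2\times2$ binary matrix $M$, the Markov-Cayley tree $\mathcal{T}\subseteq\mathcal{T}_2$ with adjacency matrix $M$ consists of $\epsilon$ and all words $f_{a_1}\cdots f_{a_k}$ ($k\ge1$, $a_j\in\{1,2\}$) with $M_{a_j,a_{j+1}}=1$ for $1\le j\le k-1$. For $X_1,X_2\subseteq\mathcal{A}^{\mathbb{N}}$, the axial product $X_1\times X_2$ on $\mathcal{T}$ is the set of $x\in\mathcal{A}^{\mathcal{T}}$ such that for every $g\in\mathcal{T}$ and $i\in\{1,2\}$, the (finite or infinite) sequence $x_g,x_{gf_i},x_{gf_i^2},\dots$, taken over all $n\ge0$ with $gf_i^n\in\mathcal{T}$, is an element of $X_i$ if infinite, and an initial word of some element of $X_i$ if finite. With $\Delta_n^{\mathcal{T}}=\{g\in\mathcal{T}:|g|\le n\}$ and $\mathcal{P}(\Delta_n^{\mathcal{T}},Y)=\{(x_g)_{g\in\Delta_n^{\mathcal{T}}}:x\in Y\}$, the entropy of $Y\subseteq\mathcal{A}^{\mathcal{T}}$ is $h(Y)=\limsup_{n\to\infty}\frac{\log|\mathcal{P}(\Delta_n^{\mathcal{T}},Y)|}{|\Delta_n^{\mathcal{T}}|}$. For a subshift $X\subseteq\mathcal{A}^{\mathbb{N}}$, $h(X)=\lim_{n\to\infty}\frac1n\log|\{(x_1,\dots,x_n):x\in X\}|$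 is the usual topological entropy. ''$X$ is not a full shift'' means $X\neq\mathcal{B}^{\mathbb{N}}$ for every nonempty $\mathcal{B}\subseteq\mathcal{A}$. $X_A=\{x\in\mathcal{A}^{\mathbb{N}}:A_{x_n,x_{n+1}}=1\ \forall n\}$; a nonnegative matrix $A$ is primitive if some power $A^N$, $N\ge1$, has all entries positive. *)

(* Defs.v *)
From HB Require Import structures.
From mathcomp Require Import all_boot all_order all_algebra.
From mathcomp Require Import all_classical all_reals all_analysis.

Set Implicit Arguments.
Unset Strict Implicit.
Unset Printing Implicit Defensive.

Import Order.TTheory GRing.Theory Num.Theory.
Import numFieldNormedType.Exports.

Local Open Scope classical_set_scope.
Local Open Scope ring_scope.

Definition binary_mx k (A : 'M[nat]_k) : Prop :=
  forall i j, A i j = 0%N \/ A i j = 1%N.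

Definition primitive_mx k (A : 'M[nat]_k) : Prop :=
  exists2 N : nat, (0 < N)%N & forall i j, (0 < (A ^+ N) i j)%N.

(* The 2-tree is [seq 'I_2], with root [::]; the generators f_1, f_2 are the
   one-letter words [:: 0] and [:: 1], and g f_i^n is [g ++ nseq n i]. *)

Definition f1 : 'I_2 := 0.
Definition f2 : 'I_2 := 1.

Definition markov_cayley (M : 'M[nat]_2) : pred (seq 'I_2) :=
  sorted (fun a b => M a b == 1%N).

Definition node (M : 'M[nat]_2) : Type := {g : seq 'I_2 | markov_cayley M g}.

Definition level (M : 'M[nat]_2) (n : nat) : finType :=
  {g : n.-tuple 'I_2 | markov_cayley M g}.

Definition ball_tree (M : 'M[nat]_2) (n : nat) : finType :=
  {g : n.-bseq 'I_2 | markov_cayley M g}.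

Definition ball_node (M : 'M[nat]_2) (n : nat) (g : ball_tree M n) : node M :=
  exist (fun w : seq 'I_2 => markov_cayley M w) (val (val g)) (valP g).

(* The terms of a sequence in A^N are numbered from 0 instead of 1. *)

Definition subshift (A : finType) (X : set (nat -> A)) : Prop :=
  closed (X : set {ptws nat -> discrete_topology A}) /\
  (forall x, X x -> X (fun n => x n.+1)).

Definition full_shift (A : finType) (B : {set A}) : set (nat -> A) :=
  [set x | forall n, x n \in B].

Definition is_full_shift (A : finType) (X : set (nat -> A)) : Prop :=
  exists2 B : {set A}, B != finset.set0 & X = full_shift B.

(* Matrices are indexed by ordinals, hence the enumeration of the alphabet. *)
Definition markov_shift (A : finType) (P : 'M[nat]_#|A|) : set (nat -> A) :=
  [set x | forall n, P (enum_rank (x n)) (enum_rank (x n.+1)) = 1%N].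

(* [x] satisfies the constraint [Y] along g, g f_i, g f_i^2, ...; a Markov-Cayley
   tree is prefix-closed, so the nodes of this form are an initial segment of
   the sequence. *)
Definition axial_constraint (A : finType) (M : 'M[nat]_2) (Y : set (nat -> A))
    (i : 'I_2) (x : node M -> A) (g : node M) : Prop :=
  let ray n := val g ++ nseq n i in
  (forall ray_in : forall n, markov_cayley M (ray n),
     Y (fun n => x (exist _ (ray n) (ray_in n)))) /\
  (~ (forall n, markov_cayley M (ray n)) ->
     exists2 y, Y y & forall n (ray_n_in : markov_cayley M (ray n)),
       x (exist _ (ray n) ray_n_in) = y n).

Definition axial_product (A : finType) (M : 'M[nat]_2)
    (X1 X2 : set (nat -> A)) : set (node M -> A) :=
  [set x | forall g, axial_constraint X1 f1 x g /\ axial_constraint X2 f2 x g].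

Definition patterns (A : finType) (M : 'M[nat]_2) (n : nat)
    (Y : set (node M -> A)) : {set {ffun ball_tree M n -> A}} :=
  [set p : {ffun ball_tree M n -> A} |
    `[< exists2 x, Y x & forall g, p g = x (ball_node g) >]]%SET.

Definition words (A : finType) (n : nat) (X : set (nat -> A)) :
    {set n.-tuple A} :=
  [set w : n.-tuple A |
    `[< exists2 x, X x & forall k : 'I_n, tnth w k = x k >]]%SET.

(* Both entropies are extended reals, so that the limits below need no
   boundedness side condition.  The convention [ln 0 = 0] only affects empty
   sets of configurations. *)

Definition tree_entropy (R : realType) (A : finType) (M : 'M[nat]_2)
    (Y : set (node M -> A)) : \bar R :=
  limn_esup (fun n : nat =>
    (ln (#|patterns n Y|%:R : R) / #|ball_tree M n|%:R)%:E).

Definition shift_entropy (R : realType) (A : finType)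
    (X : set (nat -> A)) : \bar R :=
  limn (fun n : nat => (ln (#|words n X|%:R : R) / n%:R)%:E).

Definition growth_limit (R : realType) (M : 'M[nat]_2) (gamma : R) : Prop :=
  (fun n : nat => #|level M n.+1|%:R / #|level M n|%:R : R) @ \oo --> gamma.

(* Main.v *)
Require Import Defs.
From mathcomp Require Import all_boot all_order all_algebra.
From mathcomp Require Import all_classical all_reals all_analysis.
From mathcomp Require Import lra zify.

Set Implicit Arguments.
Unset Strict Implicit.
Unset Printing Implicit Defensive.

Import Order.TTheory GRing.Theory Num.Theory.
Import numFieldNormedType.Exports.

Local Open Scope classical_set_scope.
Local Open Scope ring_scope.

(* Let [p k] be the number of words of length [k] of [X], so that by Fekete's
   lemma [h(X)] is the infimum of [ln (p k) / k].  Only one direction [i] is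
   constrained, and the ball of radius [n] splits into chains
   [w, w f_i, w f_i^2, ...], with [w] not ending in [f_i], which can be filled
   independently of each other by words of [X]; a chain of length [l]
   contributes [ln (p l) >= l h(X)] to the logarithm of the number of patterns.
   If [X] is not a full shift, then [ln (p 1) > h(X)], so each chain of length 1
   brings a fixed gain.  The words of length [n] not ending in [f_i] form such
   chains, and when [gamma > 1] they are infinitely often a positive fraction of
   the ball.

   When [M] only allows [f_2 f_2], the tree is the single ray of the powers of
   [f_2] together with the node [f_1], and the number of patterns of
   [E x X] lies between the number of words of [X] and [#|A|] times it. *)

(** * Words of a shift *)

(** Writing [n = q k + r] with [r < k] gives [u n <= q u k + O(1)], so the quotients approach their
    infimum, which nonnegativity makes finite. The second conclusion, free of division, also covers
    [n = 0]. *)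
Lemma fekete (R : realType) (u : nat -> R) :
  (forall m n, u (m + n)%N <= u m + u n) -> (forall n, 0 <= u n) ->
  exists2 h : R, (fun n => u n / n%:R) @ \oo --> h & forall n, n%:R * h <= u n.
Proof.
move=> subu u_ge0.
pose S := [set r | exists n, r = u n.+1 / n.+1%:R].
have S0 : has_inf S.
  split; first by exists (u 1%N / 1%:R); exists 0%N.
  by exists 0 => _ [n ->]; rewrite divr_ge0.
have hle n : inf S <= u n.+1 / n.+1%:R.
  by apply: ge_inf; [case: S0 | exists n].
exists (inf S); last first.
  case=> [|n]; first by rewrite mul0r.
  by rewrite mulrC -ler_pdivlMr ?hle// ltr0n.
have mulu q k : u (q * k)%N <= q%:R * u k + u 0%N.
  elim: q => [|q IH]; first by rewrite !mul0n mul0r add0r.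
  rewrite mulSn (le_trans (subu _ _))// -natr1 mulrDl mul1r.
  by move: IH; lra.
apply/cvgrPdist_le => e e0.
have [_ [k ->] kP] := inf_adherent (divr_gt0 e0 (ltr0Sn R 1)) S0.
(* This bounds, uniformly in [n], the cost of the remainder [u (n %% k.+1)] and of the term [u 0] in
   [mulu]; it is absorbed by [n * (e / 2)] for large [n]. *)
pose K := u 0%N + \sum_(i < k.+1) u i.
have K0 : 0 <= K by rewrite addr_ge0// sumr_ge0.
near=> n.
have n0 : (0 < n)%N by near: n; exists 1%N.
have nR : 0 < n%:R :> R by rewrite ltr0n.
have le1 : inf S <= u n / n%:R by rewrite -(prednK n0); exact: hle.
rewrite ler0_norm ?subr_le0// opprB lerBlDr ler_pdivrMr//.
have uq : u (n %/ k.+1 * k.+1)%N <= (n %/ k.+1)%:R * u k.+1 + u 0%N by exact: mulu.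
have ur : u (n %% k.+1)%N <= \sum_(i < k.+1) u i.
  have lt_r : (n %% k.+1 < k.+1)%N by rewrite ltn_mod.
  by rewrite (bigD1 (Ordinal lt_r))//= lerDl sumr_ge0.
have un : u n <= (n %/ k.+1)%:R * u k.+1 + K.
  rewrite {1}(divn_eq n k.+1) (le_trans (subu _ _))// /K.
  by move: uq ur; lra.
have qn : (n %/ k.+1)%:R * u k.+1 <= n%:R * (u k.+1 / k.+1%:R).
  rewrite mulrCA mulrC ler_wpM2l// ler_pdivlMr ?ltr0n// -natrM ler_nat.
  exact: leq_trunc_div.
have qe : n%:R * (u k.+1 / k.+1%:R) <= n%:R * (inf S + e / 2).
  by rewrite ler_pM2l// ltW.
have Kn : K <= n%:R * (e / 2).
  by rewrite -ler_pdivrMr ?divr_gt0//; near: n; exact: nbhs_infty_ger.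
apply: (le_trans un); apply: (le_trans (lerD qn (lexx K))).
apply: (le_trans (lerD qe Kn)); rewrite -mulrDr mulrC ler_wpM2r//.
lra.
Unshelve. all: by end_near.
Qed.

Section Words.
Variables (A : finType) (X : set (nat -> A)).
Hypothesis shiftX : forall x, X x -> X (fun n => x n.+1).

Lemma shift_iter m x : X x -> X (fun n => x (m + n)%N).
Proof.
move=> Xx; elim: m => [//|m IH].
by have := shiftX IH; congr X; apply/funext => n; rewrite addSnnS.
Qed.

Lemma wordsP n (w : n.-tuple A) :
  reflect (exists2 x, X x & forall k : 'I_n, tnth w k = x k) (w \in words n X).
Proof. by rewrite inE; exact: asboolP. Qed.

Lemma mem_words n x : X x -> [tuple x k | k < n] \in words n X.
Proof. by move=> Xx; apply/wordsP; exists x => // k; rewrite tnth_mktuple. Qed.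

Lemma card_words_gt0 n : X !=set0 -> (0 < #|words n X|)%N.
Proof. by case=> x Xx; apply/card_gt0P; exists [tuple x k | k < n]; exact: mem_words. Qed.

Lemma card_words_subadd m n :
  (#|words (m + n) X| <= #|words m X| * #|words n X|)%N.
Proof.
pose f (w : (m + n).-tuple A) :=
  ([tuple tnth w (lshift n k) | k < m], [tuple tnth w (rshift m k) | k < n]).
have f_inj : injective f.
  move=> v w fvw; apply: eq_from_tnth => k; case: (split_ordP k) => j ->.
    by have := congr1 (fun t => tnth t.1 j) fvw; rewrite !tnth_mktuple.
  by have := congr1 (fun t => tnth t.2 j) fvw; rewrite !tnth_mktuple.
rewrite -cardsX -(card_imset _ f_inj); apply/subset_leq_card/fintype.subsetP.
move=> _ /imsetP[w /wordsP[x Xx wx] ->]; rewrite inE; apply/andP; split.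
  by apply/wordsP; exists x => // k; rewrite tnth_mktuple wx.
apply/wordsP; exists (fun k => x (m + k)%N); first exact: shift_iter.
by move=> k; rewrite tnth_mktuple wx.
Qed.

Lemma shift_entropy_fekete (R : realType) : X !=set0 ->
  exists h : R, [/\ shift_entropy R X = h%:E,
    (fun n => ln (#|words n X|%:R) / n%:R) @ \oo --> h &
    forall n, n%:R * h <= ln (#|words n X|%:R)].
Proof.
move=> X0.
have [||h cvh hle] := @fekete R (fun n => ln (#|words n X|%:R)).
- move=> m n; have p0 k : 0 < (#|words k X|%:R : R) by rewrite ltr0n card_words_gt0.
  rewrite -lnM ?posrE// -natrM ler_ln ?posrE ?p0// ?ler_nat ?card_words_subadd//.
  by rewrite ltr0n muln_gt0 !card_words_gt0.
- by move=> n; rewrite ln_ge0// ler1n card_words_gt0.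
exists h; split => //; apply/cvg_lim => //.
by apply: cvg_EFin => //; exact: nearW.
Qed.

End Words.

(** Points of [X] agreeing with [x] on longer and longer prefixes converge to [x] pointwise. *)
Lemma closed_prefixes (A : finType) (X : set (nat -> A)) (x : nat -> A) :
  closed (X : set {ptws nat -> discrete_topology A}) ->
  (forall n, exists2 y, X y & forall k, (k < n)%N -> y k = x k) -> X x.
Proof.
move=> clX Xn.
have /choice[y yP] : forall n, exists y, X y /\ forall k, (k < n)%N -> y k = x k.
  by move=> n; have [y] := Xn n; exists y.
apply: (@closed_cvg _ {ptws nat -> discrete_topology A} \oo _ y X clX _ x).
  by apply: nearW => n; case: (yP n).
apply/(@pointwise_cvgP nat (discrete_topology A)) => t.
by apply: cvg_near_cst; exists t.+1 => // n /= tn; exact: (yP n).2.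
Qed.

(** If [ln (p 1) <= h], then [p n >= (p 1)^n], so every word over the letters of [X] is a word of
    [X], and closedness makes [X] the full shift on these letters. *)
Lemma ln_words1_gt (R : realType) (A : finType) (X : set (nat -> A)) (h : R) :
  subshift X -> X !=set0 -> ~ is_full_shift X ->
  (forall n, n%:R * h <= ln (#|words n X|%:R)) ->
  h < ln (#|words 1 X|%:R).
Proof.
move=> [clX shX] X0 nfull hle; rewrite ltNge; apply/negP => p1h; apply: nfull.
pose B : {set A} := [set a | [tuple of [:: a]] \in words 1 X]%SET.
have inB x n : X x -> x n \in B.
  move=> Xx; rewrite inE; apply/wordsP; exists (fun k => x (n + k)%N).
    exact: (shift_iter shX).
  by move=> k; rewrite !ord1 /= addn0.
have cardB : #|B| = #|words 1 X|.
  have ci : injective (fun a : A => [tuple of [:: a]]) by move=> a b [].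
  rewrite -(card_imset _ ci); apply: eq_card => w; apply/imsetP/idP.
    by case=> a; rewrite inE => aX ->.
  have wE : w = [tuple of [:: thead w]] by apply: eq_from_tnth => k; rewrite ord1 tnth0.
  by move=> wX; exists (thead w) => //; rewrite inE -wE.
have Bfull n (w : n.-tuple A) : (forall k, tnth w k \in B) -> w \in words n X.
  pose f (v : n.-tuple A) := [ffun k => tnth v k].
  have f_inj : injective f.
    by move=> u v /ffunP fuv; apply: eq_from_tnth => k; have := fuv k; rewrite !ffunE.
  have fB : f @: words n X \subset ffun_on (mem B).
    apply/fintype.subsetP => _ /imsetP[v /wordsP[x Xx vx] ->].
    by apply/ffun_onP => k; rewrite ffunE vx; exact: inB.
  (* On logarithms: [n ln #|B| = n ln (p 1) <= n h <= ln (p n)]. With the inclusion [fB], equality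
     of the two sets follows. *)
  have le_card : (#|ffun_on (mem B) : pred {ffun 'I_n -> A}| <= #|f @: words n X|)%N.
    rewrite (card_imset _ f_inj) card_ffun_on card_ord cardB.
    rewrite -(ler_nat R) -ler_ln ?posrE ?ltr0n ?expn_gt0 ?card_words_gt0//.
    rewrite natrX lnXn ?ltr0n ?card_words_gt0// (le_trans _ (hle n))//.
    by rewrite -[leLHS]mulr_natl ler_wpM2l.
  move=> wB; have /(subset_cardP _) := fB.
  have -> : #|f @: words n X| = #|ffun_on (mem B) : pred {ffun 'I_n -> A}|.
    by apply/eqP; rewrite eqn_leq le_card subset_leq_card.
  move=> /(_ erefl) /(_ (f w)); rewrite (mem_imset _ _ f_inj) => ->.
  by apply/ffun_onP => k; rewrite ffunE; exact: wB.
exists B.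
  by have [x Xx] := X0; apply/finset.set0Pn; exists (x 0%N); exact: inB.
apply/seteqP; split => [x Xx n|x xB]; first exact: inB.
apply: closed_prefixes => // n.
have /wordsP[y Xy yw] : [tuple x k | k < n] \in words n X.
  by apply: Bfull => k; rewrite tnth_mktuple; exact: xB.
by exists y => // k kn; have := yw (Ordinal kn); rewrite tnth_mktuple.
Qed.

(** * Levels of a Markov-Cayley tree *)

Lemma tuple_rconsP (T : Type) n (t : n.+1.-tuple T) :
  exists (u : n.-tuple T) (c : T), t = [tuple of rcons u c].
Proof.
case: t => s; case/lastP: s => [//|s c] sz.
have sz' := sz; rewrite size_rcons eqSS in sz'.
by exists (Tuple sz'), c; apply: val_inj.
Qed.

Section Levels.
Variable M : 'M[nat]_2.

Lemma markov_rcons i s c :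
  markov_cayley M (rcons s c) =
  markov_cayley M s && ((s == [::]) || (M (last i s) c == 1%N)).
Proof. by case: s => [//|x s]; rewrite /markov_cayley /= rcons_path. Qed.

Lemma card_level n :
  #|level M n| = #|[set t : n.-tuple 'I_2 | markov_cayley M t]%SET|.
Proof. by rewrite card_sig cardsE. Qed.

Lemma card_ball n :
  #|ball_tree M n| = #|[set b : n.-bseq 'I_2 | markov_cayley M b]%SET|.
Proof. by rewrite card_sig cardsE. Qed.

Lemma card_ballS n : #|ball_tree M n.+1| = (#|ball_tree M n| + #|level M n.+1|)%N.
Proof.
pose f (b : n.-bseq 'I_2) := widen_bseq (leqnSn n) b.
pose g (t : n.+1.-tuple 'I_2) : n.+1.-bseq 'I_2 := bseq_of_tuple t.
have f_inj : injective f by move=> b c /(congr1 (@bseqval _ _)) bc; exact: val_inj.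
have g_inj : injective g by move=> b c /(congr1 (@bseqval _ _)) bc; exact: val_inj.
rewrite !card_ball card_level -(card_imset _ f_inj) -(card_imset _ g_inj) -cardsUI.
rewrite [X in (_ + X)%N](_ : _ = 0%N) ?addn0; last first.
  apply: eq_card0 => b; rewrite !inE; apply/negP => /andP[/imsetP[c _ ->] /imsetP[t _]].
  move=> /(congr1 (fun x => size (val x)))/=; rewrite size_tuple => cn.
  by have := size_bseq c; rewrite cn ltnn.
apply: eq_card => b; rewrite !inE; apply/idP/orP.
  move=> Mb; have [bn|nb] := leqP (size b) n.
    left; apply/imsetP; exists (Bseq bn); first by rewrite inE.
    exact: val_inj.
  have sb : size b == n.+1 by rewrite eqn_leq nb size_bseq.
  by right; apply/imsetP; exists (Tuple sb); [rewrite inE | exact: val_inj].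
by case=> /imsetP[c cM ->]; move: cM; rewrite inE.
Qed.

Lemma card_ball_gt0 n : (0 < #|ball_tree M n|)%N.
Proof.
rewrite card_ball; apply/card_gt0P.
by exists [bseq]; rewrite inE.
Qed.

Lemma card_levelS n : (#|level M n.+1| <= 2 * #|level M n|)%N.
Proof.
rewrite !card_level -[X in (_ <= X * _)%N](card_ord 2) -cardsT -cardsX.
pose f (u : 'I_2 * n.-tuple 'I_2) := [tuple of rcons u.2 u.1].
apply: leq_trans (leq_imset_card f _); apply/subset_leq_card/fintype.subsetP => t.
have [u [c ->]] := tuple_rconsP t; rewrite inE (markov_rcons c) => /andP[Mu _].
by apply/imsetP; exists (c, u); rewrite // !inE.
Qed.

Variables (i j : 'I_2).
Hypothesis neq_ij : i != j.

Lemma letter_neq c : (c != i) = (c == j).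
Proof.
move: neq_ij (ltn_ord i) (ltn_ord j) (ltn_ord c); rewrite -!val_eqE /=.
by move: (i : nat) (j : nat) (c : nat) => [|[|?]] [|[|?]] [|[|?]].
Qed.

(* The default value [i] of [last] excludes the empty word. *)
Definition switches n :=
  [set t : n.-tuple 'I_2 | markov_cayley M t && (last i t != i)]%SET.

(** A word that ends in [i] or is empty becomes a switch one level further when [j] is appended. *)
Lemma level_switches n :
  M i j = 1%N -> (#|level M n| <= #|switches n| + #|switches n.+1|)%N.
Proof.
move=> Mij.
pose f (t : n.-tuple 'I_2) := [tuple of rcons t j].
have f_inj : injective f by move=> t u /(congr1 val)/= /rcons_inj[/val_inj].
rewrite card_level -(cardsID (switches n)) leq_add ?subset_leq_card//.
  by apply/fintype.subsetP => t; rewrite inE => /andP[].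
rewrite -(card_imset _ f_inj); apply/subset_leq_card/fintype.subsetP => _ /imsetP[t + ->].
rewrite !inE (markov_rcons i) last_rcons => /andP[+ Mt]; rewrite Mt/= negbK => /eqP ->.
by rewrite Mij eqxx orbT eq_sym.
Qed.

(** Only [j] can precede [j], so the final [j] propagates back to the first letter. *)
Lemma markov_nseq s : M i j = 0%N -> markov_cayley M s -> last i s = j ->
  s = nseq (size s) j.
Proof.
move=> Mij; elim/last_ind: s => [//|s c IH].
rewrite (markov_rcons i) last_rcons size_rcons => /andP[Ms Mc] cj; move: Mc; rewrite cj.
case: eqP => [->//|/= _]; case: (eqVneq (last i s) i) => [->|]; first by rewrite Mij.
rewrite letter_neq => /eqP /IH - /(_ Ms) -> _.
by rewrite size_nseq; elim: (size s) => //= k ->.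
Qed.

(** Words ending in [i] are determined by deleting that letter; by [markov_nseq] at most one word
    ends in [j]. *)
Lemma card_levelS_reducible n : M i j = 0%N ->
  (#|level M n.+1| <= #|level M n| + 1)%N.
Proof.
move=> Mij.
pose f (t : n.-tuple 'I_2) := [tuple of rcons t i].
rewrite !card_level -(cardsID (switches n.+1)) addnC leq_add//; last first.
  apply: (@leq_trans #|[set [tuple of nseq n.+1 j]]%SET|); last by rewrite cards1.
  apply/subset_leq_card/fintype.subsetP => t; rewrite !inE => /andP[_ /andP[Mt]].
  rewrite letter_neq => /eqP jt; apply/eqP/val_inj; rewrite /= {1}(markov_nseq Mij Mt jt).
  by rewrite size_tuple.
apply: leq_trans (leq_imset_card f _); apply/subset_leq_card/fintype.subsetP => t.
have [u [c ->]] := tuple_rconsP t.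
rewrite !inE (markov_rcons c) last_rcons => /andP[+ /andP[Mu Mc]].
rewrite Mu Mc/= negbK => /eqP ->.
by apply/imsetP; exists u; rewrite // inE.
Qed.

End Levels.

Lemma growth_ge (R : realType) (M : 'M[nat]_2) (gamma : R) :
  growth_limit M gamma -> 1 < gamma ->
  exists2 q : R, 1 < q & \forall n \near \oo,
    (0 < #|level M n|)%N /\ q * #|level M n|%:R <= #|level M n.+1|%:R.
Proof.
move=> gM g1; exists ((1 + gamma) / 2); first lra.
have lt_g : (1 + gamma) / 2 < gamma by lra.
near=> n.
have r_ge : (1 + gamma) / 2 < #|level M n.+1|%:R / #|level M n|%:R :> R.
  by near: n; exact: (cvgr_gt _ gM).
(* On an empty level the quotient would be 0, by the convention for division by zero. *)
have [L0|L0] := posnP #|level M n|.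
  by exfalso; move: r_ge; rewrite L0 invr0 mulr0; lra.
by split => //; rewrite -ler_pdivlMr ?ltr0n// ltW.
Unshelve. all: by end_near. Qed.

(* If [M i j = 0], the only word of length [n] ending in [j] is [j ... j], so that
   the level sizes grow at most linearly. *)
Lemma growth_mx_neq0 (R : realType) (M : 'M[nat]_2) (gamma : R) i j :
  i != j -> growth_limit M gamma -> 1 < gamma -> M i j <> 0%N.
Proof.
move=> ij gM g1 Mij; have [q q1 [N _ NP]] := growth_ge gM g1.
have lb k : 1 + k%:R * (q - 1) <= #|level M (N + k)|%:R :> R.
  elim: k => [|k IH].
    by rewrite mul0r addr0 addn0 ler1n; case: (NP N) => //=.
  have [] := NP (N + k)%N; first by rewrite /= leq_addr.
  rewrite addnS => L0 Lq; rewrite -natr1.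
  have L1 : 1 <= #|level M (N + k)|%:R :> R by rewrite ler1n.
  by move: IH Lq L1; nra.
have ub k : q * #|level M (N + k)|%:R <= #|level M (N + k)|%:R + 1.
  have [_ +] := NP (N + k)%N (leq_addr _ _); move=> /le_trans; apply.
  by rewrite natr1 ler_nat -[leqRHS]addn1; exact: (card_levelS_reducible ij _ Mij).
(* For [L] the size of level [N + k], [ub] gives [(q - 1) L <= 1] and [lb] gives
   [L >= 1 + k (q - 1)]; these are incompatible once [k (q - 1)^2 > 1]. *)
have [k kP] : exists k : nat, (q - 1)^-2 < k%:R.
  exists (Num.bound ((q - 1)^-2)); by apply: archi_boundP; rewrite invr_ge0 sqr_ge0.
have q0 : 0 < q - 1 by lra.
have : (q - 1) ^+2 * (q - 1)^-2 < (q - 1) ^+2 * k%:R.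
  by rewrite ltr_pM2l// exprn_gt0.
rewrite divff ?expf_neq0 ?gt_eqF// expr2.
by move: (lb k) (ub k) q0; nra.
Qed.

(** Past some [N] the levels grow at least geometrically, so the ball is dominated by its last
    level, as in a geometric sum. *)
Lemma ball_le_level (R : realType) (M : 'M[nat]_2) (gamma : R) :
  growth_limit M gamma -> 1 < gamma ->
  exists2 C : R, 0 < C & \forall n \near \oo,
    #|ball_tree M n|%:R <= C * #|level M n|%:R.
Proof.
move=> gM g1; have [q q1 [N _ NP]] := growth_ge gM g1.
(* The first summand makes the induction step work, since [C <= (C - 1) q] amounts to
   [C >= q / (q - 1)]; the second settles the base case [N]. *)
pose C := q / (q - 1) + #|ball_tree M N|%:R.
have q0 : 0 < q - 1 by lra.
have d0 : 0 < q / (q - 1) by apply: divr_gt0 => //; lra.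
have dq : q / (q - 1) * (q - 1) = q by rewrite divfK// gt_eqF.
have b0 : 0 <= #|ball_tree M N|%:R :> R by [].
exists C; first by rewrite /C; lra.
exists N => // n /= /subnKC <-; elim: (n - N)%N => [|k IH].
  have [L0 _] := NP N (leqnn N); rewrite addn0.
  have L1 : 1 <= #|level M N|%:R :> R by rewrite ler1n.
  by rewrite /C; nra.
have [L0 Lq] := NP (N + k)%N (leq_addr _ _).
rewrite addnS card_ballS natrD.
have L1 : 0 <= #|level M (N + k)|%:R :> R by [].
suff : C * #|level M (N + k)|%:R <= (C - 1) * #|level M (N + k).+1|%:R by move: IH; lra.
have C1 : C <= (C - 1) * q by rewrite /C; nra.
have C2 : 0 <= C - 1 by rewrite /C; nra.
have := ler_wpM2l C2 Lq; have := ler_wpM2r L1 C1; lra.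
Qed.

(* [L_n <= s_n + s_(n+1)] and [L_(n+1) <= 2 L_n] force [s_m >= L_m / 3] for
   [m = n] or [m = n + 1]. *)
Lemma switches_density (R : realType) (M : 'M[nat]_2) (gamma : R) i j :
  i != j -> binary_mx M -> growth_limit M gamma -> 1 < gamma ->
  exists2 c : R, 0 < c & forall N, exists2 n, (N <= n)%N &
    c * #|ball_tree M n|%:R <= #|switches M i n|%:R.
Proof.
move=> ij bM gM g1; have [C C0 [N0 _ CP]] := ball_le_level gM g1.
have Mij : M i j = 1%N by case: (bM i j) => // /(growth_mx_neq0 ij gM g1).
exists (3 * C)^-1; first by rewrite invr_gt0 mulr_gt0.
move=> N; pose n := maxn N N0.
have close m : (n <= m)%N -> #|level M m|%:R <= 3 * #|switches M i m|%:R :> R ->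
    (3 * C)^-1 * #|ball_tree M m|%:R <= #|switches M i m|%:R :> R.
  move=> nm Lm; rewrite mulrC ler_pdivrMr ?mulr_gt0//.
  apply: (le_trans (CP m _)); first by rewrite /= (leq_trans _ nm)// leq_maxr.
  by have := ler_wpM2l (ltW C0) Lm; lra.
have [Ln|Ln] := lerP (#|level M n|%:R : R) (3 * #|switches M i n|%:R).
  by exists n; [exact: leq_maxl | exact: close].
exists n.+1; first by rewrite (leq_trans (leq_maxl N N0)).
apply: close => //.
have : #|level M n.+1|%:R <= 2 * #|level M n|%:R :> R.
  by rewrite -natrM ler_nat card_levelS.
have : #|level M n|%:R <= #|switches M i n|%:R + #|switches M i n.+1|%:R :> R.
  by rewrite -natrD ler_nat; exact: (level_switches ij).
lra.
Qed.

(** * Chains in a fixed direction *)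

Lemma ln_prod_nat (R : realType) (I : finType) (F : I -> nat) :
  (forall k, 0 < F k)%N -> ln ((\prod_k F k)%N%:R : R) = \sum_k ln ((F k)%:R : R).
Proof.
move=> F0; suff [] : (0 < \prod_k F k)%N /\ ln ((\prod_k F k)%N%:R : R) = \sum_k ln ((F k)%:R : R) by [].
apply: (big_ind2 (fun (p : nat) (s : R) => (0 < p)%N /\ ln (p%:R : R) = s)).
- by rewrite ln1.
- move=> p s p' s' [p0 <-] [p'0 <-]; rewrite muln_gt0 p0 p'0; split => //.
  by rewrite natrM lnM ?posrE ?ltr0n.
- by move=> k _; split.
Qed.

Section Runs.
Variables (T : eqType) (i : T).

(** A node [s] is located in its chain by the number [run s] of its trailing letters [i] and by the
    word [start s] left after removing them. *)
Definition run (s : seq T) := find (predC1 i) (rev s).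

Definition start (s : seq T) := take (size s - run s) s.

Lemma find_nseq_cat k s :
  find (predC1 i) (nseq k i ++ s) = (k + find (predC1 i) s)%N.
Proof. by elim: k => //= k ->; rewrite eqxx. Qed.

Lemma start_run s : s = start s ++ nseq (run s) i.
Proof.
rewrite -[LHS](cat_take_drop (size s - run s)); congr (_ ++ _).
have run_le : (run s <= size s)%N by rewrite -(size_rev s) find_size.
have sz : size (drop (size s - run s) s) = run s by rewrite size_drop subKn.
apply: (@eq_from_nth _ i); first by rewrite sz size_nseq.
move=> k; rewrite sz => kr; rewrite nth_nseq kr nth_drop.
have k's : (size s - run s + k < size s)%N by lia.
have := @before_find _ i (predC1 i) (rev s) (run s - k.+1).
rewrite -/(run s) nth_rev; last lia.
have -> : (size s - (run s - k.+1).+1 = size s - run s + k)%N by lia.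
by move=> H; apply/eqP; rewrite -[_ == _]negbK; apply/negbT/H; lia.
Qed.

Lemma run_cat s k : run (s ++ nseq k i) = (run s + k)%N.
Proof. by rewrite /run rev_cat rev_nseq find_nseq_cat addnC. Qed.

Lemma start_cat s k : start (s ++ nseq k i) = start s.
Proof.
have run_le : (run s <= size s)%N by rewrite -(size_rev s) find_size.
rewrite /start run_cat size_cat size_nseq subnDr takel_cat//; exact: leq_subr.
Qed.

Lemma start_id s : start (start s) = start s.
Proof. by rewrite -(start_cat _ (run s)) -start_run. Qed.

Lemma run_start s : run (start s) = 0%N.
Proof. by have := run_cat (start s) (run s); rewrite -start_run; lia. Qed.

Lemma run_eq0 s : last i s != i -> run s = 0%N.
Proof. by elim/last_ind: s => [|s c _]; rewrite ?eqxx// last_rcons /run rev_rcons /= => ->. Qed.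

Lemma start_eq s : run s = 0%N -> start s = s.
Proof. by move=> r0; rewrite [RHS]start_run r0 cats0. Qed.

End Runs.

Lemma markov_cat M s t : markov_cayley M (s ++ t) -> markov_cayley M s.
Proof. by move=> /cat_sorted2[]. Qed.

(* [E x X] and [X x E] are the cases [i = f2] and [i = f1]. *)
Definition axial_free (A : finType) (M : 'M[nat]_2) (X : set (nat -> A)) (i : 'I_2) :
    set (node M -> A) :=
  [set x | forall g, axial_constraint X i x g].

(** Only a finite ray needs an argument: its labels are continued to an infinite sequence by an
    arbitrary letter, here [x g]. *)
Lemma axial_constraintT (A : finType) (M : 'M[nat]_2) i (x : node M -> A) g :
  axial_constraint setT i x g.
Proof.
split=> // _.
have /choice[y yP] : forall n, exists a, forall r : markov_cayley M (val g ++ nseq n i),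
    x (exist _ (val g ++ nseq n i) r) = a.
  move=> n; have [r|nr] := pselect (markov_cayley M (val g ++ nseq n i)).
    by exists (x (exist _ (val g ++ nseq n i) r)) => r'; rewrite (bool_irrelevance r r').
  by exists (x g) => r; case: (nr r).
by exists y.
Qed.

Lemma axial_product_setTl (A : finType) (M : 'M[nat]_2) (X : set (nat -> A)) :
  @axial_product A M setT X = axial_free X f2.
Proof.
apply/seteqP; split=> [x xP g|x xP g]; first by case: (xP g).
by split; [exact: axial_constraintT | exact: xP].
Qed.

Lemma axial_product_setTr (A : finType) (M : 'M[nat]_2) (X : set (nat -> A)) :
  @axial_product A M X setT = axial_free X f1.
Proof.
apply/seteqP; split=> [x xP g|x xP g]; first by case: (xP g).
by split; [exact: xP | exact: axial_constraintT].
Qed.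

Section Chains.
Variables (A : finType) (M : 'M[nat]_2) (X : set (nat -> A)) (i : 'I_2).
Hypothesis shiftX : forall x, X x -> X (fun n => x n.+1).
Hypothesis X0 : X !=set0.

(** [Y] chooses one sequence for each chain start, and the chain is labelled by the beginning of
    that sequence. *)
Definition glue (Y : seq 'I_2 -> nat -> A) (g : node M) : A :=
  Y (start i (val g)) (run i (val g)).

(** The ray in direction [i] from any node is a tail of its chain, so it reads a shifted copy of a
    point of [X]. *)
Lemma glue_axial Y : (forall s, X (Y s)) -> axial_free X i (glue Y).
Proof.
move=> YX g.
have shY : X (fun n => Y (start i (val g)) (run i (val g) + n)%N).
  exact: (shift_iter shiftX).
split=> [r|_].
  by move: shY; congr X; apply/funext => n; rewrite /glue /= start_cat run_cat.
by eexists; [exact: shY | move=> n r; rewrite /glue /= start_cat run_cat].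
Qed.

Variable n : nat.

Definition word_of (g : ball_tree M n) : seq 'I_2 := val (val g).

Lemma word_of_inj : injective word_of.
Proof. by move=> g h gh; apply/val_inj/val_inj. Qed.

Lemma ball_ex s : markov_cayley M s -> (size s <= n)%N ->
  exists g : ball_tree M n, word_of g = s.
Proof. by move=> Ms sn; exists (exist (fun b : n.-bseq 'I_2 => markov_cayley M b) (Bseq sn) Ms). Qed.

Lemma size_word_of g : (size (word_of g) <= n)%N.
Proof. exact: size_bseq. Qed.

Lemma ball_start_ex g : exists h, word_of h == start i (word_of g).
Proof.
suff [h hg] : exists h, word_of h = start i (word_of g) by exists h; apply/eqP.
apply: ball_ex; last by rewrite (leq_trans _ (size_word_of g))// size_take; case: ifP => //; lia.
by apply: (@markov_cat _ _ (nseq (run i (word_of g)) i)); rewrite -start_run; exact: (valP g).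
Qed.

Definition ball_start g : ball_tree M n := xchoose (ball_start_ex g).

Lemma ball_startE g : word_of (ball_start g) = start i (word_of g).
Proof. by apply/eqP; exact: (xchooseP (ball_start_ex g)). Qed.

(** This is 0 when [w] ends in [i], so such [w] contribute 0 to sums of lengths and, for nonempty
    [X], a factor 1 to products of numbers of words. *)
Definition chain_length w := #|[set g | ball_start g == w]%SET|.

Lemma sum_chain_length : (\sum_w chain_length w)%N = #|ball_tree M n|.
Proof.
rewrite -sum1_card [RHS](partition_big ball_start predT)//=.
apply: eq_bigr => w _; rewrite -[LHS]sum1_card.
by apply: eq_bigl => g; rewrite inE.
Qed.

(** Nodes of one chain have distinct runs. If all runs were below [k], the chain would have at most
    [k] nodes; hence some node has run at least [k], and removing trailing letters [i] from it
    reaches run exactly [k]. *)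
Lemma chain_node w k : (k < chain_length w)%N ->
  exists g, start i (word_of g) = word_of w /\ run i (word_of g) = k.
Proof.
move=> kl.
have [g0 [g0w kg0]] : exists g, ball_start g = w /\ (k <= run i (word_of g))%N.
  apply: contrapT => nex.
  pose J := [set g | ball_start g == w]%SET.
  have run_lt g : g \in J -> (run i (word_of g) < k)%N.
    by rewrite inE => /eqP gw; rewrite ltnNge; apply/negP => kr; apply: nex; exists g.
  have un : uniq [seq run i (word_of g) | g <- enum J].
    rewrite map_inj_in_uniq ?enum_uniq// => g g'; rewrite !mem_enum !inE.
    move=> /eqP gw /eqP g'w rgg'; apply: word_of_inj.
    by rewrite (start_run i (word_of g)) (start_run i (word_of g')) rgg' -!ball_startE gw g'w.
  have : (size [seq run i (word_of g) | g <- enum J] <= size (iota 0 k))%N.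
    apply: uniq_leq_size => // r /mapP[g]; rewrite mem_enum => /run_lt gk ->.
    by rewrite mem_iota.
  by rewrite size_map size_iota -cardE leqNgt kl.
have g0E : word_of g0 = word_of w ++ nseq (run i (word_of g0)) i.
  by rewrite -g0w ball_startE -start_run.
have [g gE] : exists g, word_of g = word_of w ++ nseq k i.
  have g0E' : word_of g0 = (word_of w ++ nseq k i) ++ nseq (run i (word_of g0) - k) i.
    by rewrite -catA -nseqD subnKC.
  apply: ball_ex.
    by apply: (@markov_cat _ _ (nseq (run i (word_of g0) - k) i)); rewrite -g0E'; exact: (valP g0).
  by rewrite (leq_trans _ (size_word_of g0))// [in leqRHS]g0E' [leqRHS]size_cat leq_addr.
have wE : word_of w = start i (word_of g0) by rewrite -ball_startE g0w.
exists g; rewrite gE start_cat run_cat wE run_start start_id; split => //.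
Qed.

(** Choosing one word of [X] of the right length for each chain, extending each to a point of [X]
    and gluing gives an injection into the patterns. *)
Lemma card_patterns_ge :
  (\prod_(w : ball_tree M n) #|words (chain_length w) X| <=
   #|patterns n (@axial_free A M X i)|)%N.
Proof.
have [x0 Xx0] := X0.
(* [pt] extends a word of [X] to a point of [X]; on other tuples it returns the dummy point [x0]. *)
have /choice[pt ptP] : forall kv : {k & k.-tuple A}, exists x, X x /\
    (tagged kv \in words (tag kv) X -> forall j, tnth (tagged kv) j = x j).
  move=> [k v]; have [/wordsP[x Xx xv]|nv] := boolP (v \in words k X).
    by exists x.
  by exists x0; split => //= vX; rewrite vX in nv.
pose D w : finType := {v : (chain_length w).-tuple A | v \in words (chain_length w) X}.
have -> : (\prod_(w : ball_tree M n) #|words (chain_length w) X|)%N =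
    #|{dffun forall w, D w}|.
  rewrite card_dep_ffun foldrE big_image; apply: eq_bigr => w _.
  by rewrite card_sig.
pose Y (f : {dffun forall w, D w}) s :=
  if [pick w | word_of w == s] is Some w
  then pt (Tagged (fun k => k.-tuple A) (val (f w))) else x0.
have YE f w : Y f (word_of w) = pt (Tagged (fun k => k.-tuple A) (val (f w))).
  rewrite /Y; case: pickP => [w' /eqP/word_of_inj -> //|/(_ w)].
  by rewrite eqxx.
have YX f s : X (Y f s).
  by rewrite /Y; case: pickP => [w _|_ //]; case: (ptP (Tagged (fun k => k.-tuple A) (val (f w)))).
pose Psi f := [ffun g : ball_tree M n => glue (Y f) (ball_node g)].
(* By [chain_node] every position of every chosen word is read at some node of the ball. *)
have Psi_inj : injective Psi.
  move=> f f' /ffunP ff'; apply/ffunP => w; apply/val_inj/eq_from_tnth => k.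
  have [g [gw gk]] := chain_node (ltn_ord k).
  have := ff' g; rewrite !ffunE /glue -[val _]/(word_of g) gw gk !YE.
  have [_ /(_ (valP (f w)))/(_ k) <-] := ptP (Tagged (fun k => k.-tuple A) (val (f w))).
  by have [_ /(_ (valP (f' w)))/(_ k) <-] := ptP (Tagged (fun k => k.-tuple A) (val (f' w))).
rewrite -(card_codom Psi_inj); apply/subset_leq_card/fintype.subsetP => _ /codomP[f ->].
rewrite inE; apply/asboolP; exists (glue (Y f)); last by move=> g; rewrite ffunE.
exact: glue_axial.
Qed.

(** A word of length [n] not ending in [i] starts a chain, and its successor in direction [i] is
    already outside the ball. *)
Lemma switches_chain :
  (#|switches M i n| <= #|[set w | chain_length w == 1%N]%SET|)%N.
Proof.
have /choice[f fE] : forall t : n.-tuple 'I_2, exists w : ball_tree M n,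
    t \in switches M i n -> word_of w = t.
  move=> t; have [|nt] := boolP (t \in switches M i n).
    rewrite inE => /andP[Mt _]; have [|w wt] := ball_ex Mt; first by rewrite size_tuple.
    by exists w.
  by have [w _] := @ball_ex [::] isT (leq0n n); exists w.
have f_inj : {in switches M i n &, injective f}.
  by move=> t u tS uS tu; apply: val_inj; rewrite /= -fE// tu fE.
rewrite -(card_in_imset f_inj); apply/subset_leq_card/fintype.subsetP => _ /imsetP[t tS ->].
have rt : run i t = 0%N by apply: run_eq0; move: tS; rewrite inE => /andP[].
rewrite inE; apply/cards1P; exists (f t); apply/setP => g; rewrite !inE.
apply/eqP/eqP => [gt|->]; apply: word_of_inj.
  have sg : start i (word_of g) = t by rewrite -ball_startE gt fE.
  have : (size (word_of g) <= n)%N := size_word_of g.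
  rewrite (start_run i (word_of g)) sg fE// size_cat size_tuple size_nseq -[leqRHS]addn0 leq_add2l.
  by rewrite leqn0 => /eqP ->; rewrite cats0.
by rewrite ball_startE fE// start_eq.
Qed.

Lemma ln_patterns_ge (R : realType) (h : R) :
  (forall k, k%:R * h <= ln (#|words k X|%:R)) ->
  h * #|ball_tree M n|%:R + (ln (#|words 1 X|%:R) - h) * #|switches M i n|%:R
    <= ln (#|patterns n (@axial_free A M X i)|%:R).
Proof.
move=> hle; have d0 : 0 <= ln (#|words 1 X|%:R) - h by have := hle 1%N; lra.
have prod0 : (0 < \prod_(w : ball_tree M n) #|words (chain_length w) X|)%N.
  by rewrite prodn_gt0// => w; exact: card_words_gt0.
have lnle : ln ((\prod_(w : ball_tree M n) #|words (chain_length w) X|)%N%:R : R) <=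
    ln (#|patterns n (@axial_free A M X i)|%:R).
  rewrite ler_ln ?posrE ?ltr0n// ?ler_nat ?card_patterns_ge//.
  exact: leq_trans prod0 card_patterns_ge.
apply: le_trans lnle; rewrite ln_prod_nat => [|w]; last exact: card_words_gt0.
rewrite -sum_chain_length natr_sum mulr_sumr.
(* The gain [ln (p 1) - h] is nonnegative, so the number of switches may be replaced by the number
   of chains of length 1, and the comparison is made chain by chain. *)
have := switches_chain; rewrite -(ler_nat R) => /(ler_wpM2l d0).
rewrite -[X in _ <= _ * X%:R]sum1_card natr_sum mulr_sumr big_mkcond/= => sw.
apply: (le_trans (lerD (lexx _) sw)); rewrite -big_split/=; apply: ler_sum => w _.
rewrite inE; case: eqP => [->|_]; first by lra.
by rewrite addr0 mulrC.
Qed.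

End Chains.

(** * Entropy of axial products *)

Lemma limn_esup_ge_often (R : realType) (u : (\bar R)^nat) (x : \bar R) :
  (forall N, exists2 n, (N <= n)%N & (x <= u n)%E) -> (x <= limn_esup u)%E.
Proof.
move=> often; rewrite limn_esup_lim; apply: lime_ge; first exact: is_cvg_esups.
apply: nearW => N; have [n Nn xn] := often N; apply: (le_trans xn).
by apply: ereal_sup_ubound; exists n.
Qed.

Lemma tree_entropy_gt (R : realType) (M : 'M[nat]_2) (gamma : R) (A : finType)
    (X : set (nat -> A)) i j :
  i != j -> binary_mx M -> growth_limit M gamma -> 1 < gamma ->
  subshift X -> X !=set0 -> ~ is_full_shift X ->
  (shift_entropy R X < tree_entropy R (@axial_free A M X i))%E.
Proof.
move=> ij bM gM g1 sX X0 nfull; have [_ shX] := sX.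
have [h [-> _ hle]] := shift_entropy_fekete shX R X0.
have d0 := ln_words1_gt sX X0 nfull hle.
have [c c0 dens] := switches_density ij bM gM g1.
(* At the radii given by [dens], the switches are at least a fraction [c] of the ball and each gains
   [ln (p 1) - h]. *)
apply: (@lt_le_trans _ _ (h + (ln #|words 1 X|%:R - h) * c)%:E).
  by rewrite lte_fin ltrDl mulr_gt0// subr_gt0.
apply: limn_esup_ge_often => N; have [n Nn cn] := dens N; exists n => //.
rewrite lee_fin ler_pdivlMr ?ltr0n ?card_ball_gt0//.
apply: (le_trans _ (@ln_patterns_ge A M X i shX X0 n R h hle)).
rewrite mulrDl lerD2l -mulrA ler_wpM2l// subr_ge0; exact: ltW.
Qed.

(** * The tree consisting of one ray and one extra node *)

Section SingleRay.

Definition ray_mx : 'M[nat]_2 := \matrix_(a, b) nat_of_bool ((a == f2) && (b == f2)).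

Lemma ray_mx_nseq k : markov_cayley ray_mx (nseq k f2).
Proof.
elim: k => [//|k]; rewrite /markov_cayley /=; case: k => //= k ->.
by rewrite mxE.
Qed.

Lemma ray_mxP s : markov_cayley ray_mx s -> s = [:: f1] \/ s = nseq (size s) f2.
Proof.
move=> Ms; have [sf1|] := eqVneq (last f1 s) f1; last first.
  rewrite (letter_neq (j := f2))// => /eqP sf2; right.
  by apply: (markov_nseq (i := f1) _ _ Ms sf2) => //; rewrite mxE.
case/lastP: s Ms sf1 => [|s c]; first by right.
rewrite (markov_rcons ray_mx f1) last_rcons => /andP[_ /orP[/eqP -> ->|]]; first by left.
by rewrite mxE => + c1; rewrite c1 andbF.
Qed.

(** The index starts at 2 because level 1 also contains [[:: f1]]. *)
Lemma card_level_ray n : #|level ray_mx n.+2| = 1%N.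
Proof.
rewrite card_level; apply/eqP/cards1P; exists [tuple of nseq n.+2 f2].
apply/setP => t; rewrite !inE; apply/idP/eqP => [/ray_mxP[t1|tE]|->].
- by have := size_tuple t; rewrite t1.
- by apply: val_inj; rewrite /= {1}tE size_tuple.
- exact: ray_mx_nseq.
Qed.

Lemma card_ball_ray_ge n : (n < #|ball_tree ray_mx n|)%N.
Proof.
elim: n => [|n IH]; first exact: card_ball_gt0.
rewrite card_ballS -addn1 leq_add// card_level; apply/card_gt0P.
by exists [tuple of nseq n.+1 f2]; rewrite inE ray_mx_nseq.
Qed.

Lemma growth_ray (R : realType) : growth_limit ray_mx (1 : R).
Proof.
apply: cvg_near_cst; exists 2%N => // -[|[|n]] //= _.
by rewrite !card_level_ray divr1.
Qed.

Variables (A : finType) (X : set (nat -> A)).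

Lemma axial_ray (x : node ray_mx -> A) : axial_free X f2 x ->
  X (fun k => x (exist _ (nseq k f2) (ray_mx_nseq k))).
Proof. by move=> /(_ (exist _ [::] isT))[/(_ ray_mx_nseq)]. Qed.

(** A pattern is determined by its labels along the [n.+2] nodes of the ray, which spell a word of
    [X], and by its label at [[:: f1]], a node present from radius 1 on. *)
Lemma card_patterns_ray n :
  (#|patterns n.+1 (@axial_free A ray_mx X f2)| <= #|words n.+2 X| * #|A|)%N.
Proof.
have /choice[g gE] : forall k : 'I_n.+2, exists w : ball_tree ray_mx n.+1, word_of w = nseq k f2.
  by move=> k; apply: ball_ex; rewrite ?ray_mx_nseq// size_nseq -ltnS.
have [g1 g1E] : exists w : ball_tree ray_mx n.+1, word_of w = [:: f1] by apply: ball_ex.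
pose F (p : {ffun ball_tree ray_mx n.+1 -> A}) := ([tuple p (g k) | k < n.+2], p g1).
have F_inj : injective F.
  move=> p q pq; apply/ffunP => w.
  have [w1|wE] := ray_mxP (valP w).
    have -> : w = g1 by apply: word_of_inj; rewrite g1E.
    exact: (congr1 snd pq).
  have wk : (size (word_of w) < n.+2)%N by rewrite ltnS; exact: size_word_of.
  have -> : w = g (Ordinal wk) by apply: word_of_inj; rewrite gE.
  have := congr1 (fun t => tnth t.1 (Ordinal wk)) pq; by rewrite !tnth_mktuple.
rewrite -(card_imset _ F_inj) -[#|A|]cardsT -cardsX.
apply/subset_leq_card/fintype.subsetP => _ /imsetP[p + ->].
rewrite inE => /asboolP[x xP px]; rewrite finset.in_setX finset.in_setT andbT.
apply/wordsP; exists (fun k => x (exist _ (nseq k f2) (ray_mx_nseq k))); first exact: axial_ray.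
move=> k; rewrite tnth_mktuple px; congr x; apply: val_inj; exact: gE.
Qed.

Lemma tree_entropy_ray (R : realType) : (forall x, X x -> X (fun n => x n.+1)) ->
  tree_entropy R (@axial_free A ray_mx X f2) = shift_entropy R X.
Proof.
(* For empty [X] both entropies are limits of the zero sequence, because [ln 0 = 0]. *)
move=> shX; have [X0|/nonemptyPn X0] := pselect (X !=set0); last first.
  have p0 n : #|patterns n (@axial_free A ray_mx X f2)| = 0%N.
    apply: eq_card0 => p; rewrite inE; apply/negP => /asboolP[x /axial_ray].
    by rewrite X0.
  have w0 n : #|words n X| = 0%N.
    by apply: eq_card0 => w; apply/negP => /wordsP[x]; rewrite X0.
  rewrite /tree_entropy /shift_entropy.
  under eq_fun do rewrite p0 ln0// mul0r.
  under [in RHS]eq_fun do rewrite w0 ln0// mul0r.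
  have c0 : (fun=> 0%:E : \bar R) @ \oo --> (0%:E : \bar R) by exact: cvg_cst.
  by rewrite (cvg_limn_einf_sup c0).2; apply/esym/cvg_lim.
have [h [-> cvh hle]] := shift_entropy_fekete shX R X0.
pose u n := ln (#|patterns n (@axial_free A ray_mx X f2)|%:R : R) / #|ball_tree ray_mx n|%:R.
suff cvu : u @ \oo --> h.
  apply: (cvg_limn_einf_sup _).2; apply: cvg_EFin => //; exact: nearW.
(* The upper bound comes from [card_patterns_ray], dividing by [n.+1], a lower bound for the size of
   the ball of radius [n]; the free label costs [ln #|A| / n.+1]. *)
have cvup : (fun n => ln (#|words n.+1 X|%:R : R) / n.+1%:R + ln #|A|%:R * harmonic n) @ \oo --> h.
  rewrite -[h]addr0 -[X in _ + X](mulr0 (ln #|A|%:R)).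
  apply: cvgD; first by move: cvh; rewrite -(cvg_shiftS (fun n => ln #|words n X|%:R / n%:R)).
  by apply: cvgM; [exact: cvg_cst | exact: cvg_harmonic].
apply: (squeeze_cvgr _ (cvg_cst h) cvup); exists 1%N => // -[//|n] _ /=.
have b0 : 0 < #|ball_tree ray_mx n.+1|%:R :> R by rewrite ltr0n card_ball_gt0.
have lo := @ln_patterns_ge A ray_mx X f2 shX X0 n.+1 R h hle.
have d0 : 0 <= (ln #|words 1 X|%:R - h) * #|switches ray_mx f2 n.+1|%:R.
  by rewrite mulr_ge0// subr_ge0; have := hle 1%N; rewrite mul1r.
have ln_p : h * #|ball_tree ray_mx n.+1|%:R <= ln #|patterns n.+1 (@axial_free A ray_mx X f2)|%:R.
  by move: lo d0; lra.
have A0 : (0 < #|A|)%N by case: X0 => x _; apply/card_gt0P; exists (x 0%N).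
have w0 : (0 < #|words n.+2 X|)%N by exact: card_words_gt0.
rewrite /u ler_pdivlMr// ln_p/= ler_pdivrMr//.
have up : ln #|patterns n.+1 (@axial_free A ray_mx X f2)|%:R <= ln #|words n.+2 X|%:R + ln #|A|%:R :> R.
  have [->|pn0] := posnP #|patterns n.+1 (@axial_free A ray_mx X f2)|.
    by rewrite ln0// addr_ge0// ln_ge0// ler1n.
  rewrite -lnM ?posrE ?ltr0n// -natrM ler_ln ?posrE ?ltr0n ?muln_gt0 ?w0//.
  by rewrite ler_nat card_patterns_ray.
apply: (le_trans up); rewrite /harmonic -mulrDl mulrAC ler_pdivlMr//.
rewrite ler_wpM2l//; last by rewrite ler_nat card_ball_ray_ge.
by rewrite addr_ge0// ln_ge0// ler1n.
Qed.

End SingleRay.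

Theorem theorem4p3 (R : realType) :
  (forall (M : 'M[nat]_2) (gamma : R),
     binary_mx M -> growth_limit M gamma -> 1 < gamma ->
   forall (A : finType) (X : set (nat -> A)),
     subshift X -> X !=set0 -> ~ is_full_shift X ->
     (shift_entropy R X < tree_entropy R (@axial_product A M setT X))%E /\
     (shift_entropy R X < tree_entropy R (@axial_product A M X setT))%E)
  /\
  (exists M : 'M[nat]_2,
     [/\ binary_mx M, growth_limit M (1 : R) &
      forall (A : finType) (P : 'M[nat]_#|A|),
        binary_mx P -> primitive_mx P ->
        tree_entropy R (@axial_product A M setT (markov_shift P))
          = shift_entropy R (markov_shift P)]).
Proof.
split.
  move=> M gamma bM gM g1 A X sX X0 nfull; split.
    by rewrite axial_product_setTl; apply: (tree_entropy_gt (j := f1) _ bM gM g1).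
  by rewrite axial_product_setTr; apply: (tree_entropy_gt (j := f2) _ bM gM g1).
exists ray_mx; split; [|exact: growth_ray|].
  by move=> a b; rewrite mxE; case: andP; [right | left].
move=> A P _ _; rewrite axial_product_setTl; apply: tree_entropy_ray => x xP n.
exact: xP.
Qed.
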